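(* Let $p$ be a prime. A clarified $C_p$-Tambara field $k$ of characteristic $p$ with trivial $C_p$-action on the bottom level $k(C_p/e)$ is the same data as a choice of a field $k(C_p/e)$ of characteristic $p$ together with a subfield $k(C_p/C_p) \subseteq k(C_p/e)$ which contains the image of the Frobenius endomorphism $x\mapsto x^p$ of $k(C_p/e)$. That is: for every such $k$, the restriction map identifies $k(C_p/C_p)$ with a subfield of the field $k(C_p/e)$ containing the image of Frobenius; and conversely, for every field $F$ of characteristic $p$ and subfield $E\subseteq F$ containing $\{x^p : x\in F\}$, there is a unique sub-Tambara functor of the fixed-point functor $\underline{F}$ (with $C_p$ acting trivially on $F$) having bottom level $F$ and top level $E$, and it is a clarified $C_p$-Tambara field of characteristic $p$.
   Context: For a finite group $G$, a $G$-Tambara functor $k$ assigns to each finite $G$-set $X$ a commutative ring $k(X)$ (taking disjoint unions to products) and to each map $X \to Y$ of finite $G$-sets a restriction $k(Y)\to k(X)$ (a ring map), an additive transfer $k(X)\to k(Y)$ and a multiplicative norm $k(X)\to k(Y)$, satisfying the standard axioms (as in Tambara, Strickland). The group $G$ acts on $k(G/e)$, called the bottom level; $k(G/G)$ is the top level. A nonzero $G$-Tambara functor $k$ is a $G$-Tambara field (field-like) if every morphism $k \to \ell$ with $\ell \neq 0$ is monic. (Nakaoka: equivalently, all restriction maps of $k$ are injective and $k(G/e)$ is nonzero with no nontrivial $G$-invariant ideals.) For $H\subset G$ and an $H$-ring $R$ (a commutative ring with $H$-action), $\mathrm{Coind}_H^G R=\mathrm{Fun}(G/H,R)$ is the coinduced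 $G$-ring (value of the right adjoint to restriction of rings with action). A field-like $k$ is separated if $k(G/e) \cong \mathrm{Coind}_H^G R$ as $G$-rings for some proper subgroup $H$ and $H$-ring $R$; otherwise it is clarified. (Equivalently, a field-like $k$ is clarified iff $k(G/e)$ is a field.) The characteristic of a field-like $k$ is the characteristic of the ring $k(G/e)$. For a $G$-ring $R$, the fixed-point Tambara functor $\underline{R}$ has $\underline{R}(G/H)=R^H$, with restrictions the inclusions and transfers (resp. norms) the sums (resp. products) over cosets. A field-like $k$ embeds in $\underline{k(G/e)}$ via its restriction maps. *)

(* Defs.v *)
From HB Require Import structures.
From Stdlib Require Import FunctionalExtensionality.
From mathcomp Require Import all_boot all_fingroup all_algebra all_solvable.

Set Implicit Arguments.
Unset Strict Implicit.
Unset Printing Implicit Defensive.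

Import GroupScope GRing.Theory.
Local Open Scope ring_scope.

(* All actions are right actions, as everywhere in MathComp: a left action    *)
(* g . x corresponds to the right action x . g^-1.                            *)

Section GSets.

Variable gT : finGroupType.

Record gset := GSet {
  gset_sort :> finType;
  gset_act : {action gT &-> gset_sort} }.

Record gmap (X Y : gset) := GMap {
  gmap_fun :> X -> Y;
  gmap_equiv : forall x g, gmap_fun (gset_act X x g) = gset_act Y (gmap_fun x) g }.

Lemma gmapP X Y (f g : gmap X Y) : f =1 g -> f = g.
Proof.
case: f g => [f fP] [g gP] /= /functional_extensionality efg.
case: _ / efg in gP *; congr GMap.
do 2!apply: functional_extensionality_dep => ?; exact: eq_irrelevance.
Qed.

Definition gmap_id (X : gset) : gmap X X := @GMap X X id (fun _ _ => erefl).

Fact gmap_comp_equiv X Y Z (g : gmap Y Z) (f : gmap X Y) x a :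
  (g \o f) (gset_act X x a) = gset_act Z ((g \o f) x) a.
Proof. by rewrite /= !gmap_equiv. Qed.
Definition gmap_comp X Y Z (g : gmap Y Z) (f : gmap X Y) : gmap X Z :=
  GMap (gmap_comp_equiv g f).

(* G/e: the group acting on itself by right translation. *)
Definition free_orbit : gset := @GSet gT 'R.

(* G/G *)
Definition point : gset :=
  @GSet unit (@TotalAction gT unit (fun x _ => x) (fun _ => erefl) (fun _ _ _ => erefl)).

Definition to_point (X : gset) : gmap X point :=
  @GMap X point (fun _ => tt) (fun _ _ => erefl).

Definition ltrans (g : gT) : gmap free_orbit free_orbit :=
  @GMap free_orbit free_orbit (fun x => (g * x)%g) (fun x a => mulgA g x a).

Definition is_coproduct (X Y Z : gset) (i : gmap X Z) (j : gmap Y Z) : Prop :=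
  bijective (fun s : X + Y => match s with inl x => i x | inr y => j y end).

(*        g'
      W ----> X
   f' |       | f
      v       v
      Y' ---> Y
          g                                                                   *)
Definition is_pullback (X Y Y' W : gset) (f : gmap X Y) (g : gmap Y' Y)
    (f' : gmap W Y') (g' : gmap W X) : Prop :=
  (forall w, f (g' w) = g (f' w)) /\
  (forall x y', f x = g y' -> exists! w, g' w = x /\ f' w = y').

(*         q      e
       X <--- A <--- B
     f |             | f'
       v             v
       Y <---------- P
              r
   The outer rectangle is cartesian, and P is the dependent product of A
   along f: points of P over y correspond to the sections s of q over the
   fibre of f at y, the section attached to c being read off through e.       *)
Definition is_exponential (A X Y P B : gset) (q : gmap A X) (f : gmap X Y)
    (e : gmap B A) (f' : gmap B P) (r : gmap P Y) : Prop :=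
  is_pullback f r f' (gmap_comp q e) /\
  (forall (y : Y) (s : {x : X | f x == y} -> A),
     (forall x, q (s x) = val x) ->
     exists! c : P, r c = y /\
       forall (b : B) (x : {x : X | f x == y}),
         f' b = c -> q (e b) = val x -> e b = s x).

End GSets.

Arguments free_orbit gT : clear implicits.
Arguments point gT : clear implicits.

Section Tambara.

Variable gT : finGroupType.
Implicit Types X Y Z : gset gT.

Record tambara := Tambara {
  level :> gset gT -> comPzRingType;
  res : forall X Y, gmap X Y -> level Y -> level X;
  tr : forall X Y, gmap X Y -> level X -> level Y;
  nm : forall X Y, gmap X Y -> level X -> level Y;
  res_zmod : forall X Y (f : gmap X Y), zmod_morphism (res f);
  res_monoid : forall X Y (f : gmap X Y), monoid_morphism (res f);
  tr_zmod : forall X Y (f : gmap X Y), zmod_morphism (tr f);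
  nm_monoid : forall X Y (f : gmap X Y), monoid_morphism (nm f);
  res_id : forall X, res (gmap_id X) =1 id;
  tr_id : forall X, tr (gmap_id X) =1 id;
  nm_id : forall X, nm (gmap_id X) =1 id;
  res_comp : forall X Y Z (g : gmap Y Z) (f : gmap X Y),
    res (gmap_comp g f) =1 res f \o res g;
  tr_comp : forall X Y Z (g : gmap Y Z) (f : gmap X Y),
    tr (gmap_comp g f) =1 tr g \o tr f;
  nm_comp : forall X Y Z (g : gmap Y Z) (f : gmap X Y),
    nm (gmap_comp g f) =1 nm g \o nm f;
  level_empty : forall X, #|X| = 0%N -> forall a : level X, a = 0;
  level_coproduct : forall X Y Z (i : gmap X Z) (j : gmap Y Z),
    is_coproduct i j -> bijective (fun a : level Z => (res i a, res j a));
  tr_pullback : forall X Y Y' W (f : gmap X Y) (g : gmap Y' Y)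
      (f' : gmap W Y') (g' : gmap W X),
    is_pullback f g f' g' -> res g \o tr f =1 tr f' \o res g';
  nm_pullback : forall X Y Y' W (f : gmap X Y) (g : gmap Y' Y)
      (f' : gmap W Y') (g' : gmap W X),
    is_pullback f g f' g' -> res g \o nm f =1 nm f' \o res g';
  nm_tr : forall A X Y P B (q : gmap A X) (f : gmap X Y)
      (e : gmap B A) (f' : gmap B P) (r : gmap P Y),
    is_exponential q f e f' r -> nm f \o tr q =1 tr r \o nm f' \o res e }.

Record tmor (k l : tambara) := TMor {
  tmor_fun :> forall X, k X -> l X;
  tmor_zmod : forall X, zmod_morphism (@tmor_fun X);
  tmor_monoid : forall X, monoid_morphism (@tmor_fun X);
  tmor_res : forall X Y (f : gmap X Y) (a : k Y),
    tmor_fun (res f a) = res f (tmor_fun a);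
  tmor_tr : forall X Y (f : gmap X Y) (a : k X),
    tmor_fun (tr f a) = tr f (tmor_fun a);
  tmor_nm : forall X Y (f : gmap X Y) (a : k X),
    tmor_fun (nm f a) = nm f (tmor_fun a) }.

Definition monic (k l : tambara) (f : tmor k l) : Prop :=
  forall (m : tambara) (u v : tmor m k),
    (forall X (a : m X), f X (u X a) = f X (v X a)) ->
    forall X (a : m X), u X a = v X a.

Definition nonzero (k : tambara) : Prop := exists X (a : k X), a != 0.

Definition field_like (k : tambara) : Prop :=
  nonzero k /\ forall (l : tambara) (f : tmor k l), nonzero l -> monic f.

End Tambara.

Record gring (gT : finGroupType) (D : {set gT}) := GRingWithAct {
  gring_sort :> comPzRingType;
  gring_act : action D gring_sort;
  gring_act_zmod : forall g, g \in D -> zmod_morphism (gring_act^~ g);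
  gring_act_monoid : forall g, g \in D -> monoid_morphism (gring_act^~ g) }.

Definition gring_iso (gT : finGroupType) (D : {set gT}) (R S : gring D) : Prop :=
  exists phi : {rmorphism R -> S},
    bijective phi /\
    forall g x, g \in D -> phi (gring_act R x g) = gring_act S (phi x) g.

Definition trivial_gring (gT : finGroupType) (R : comPzRingType) :
    gring [set: gT] :=
  @GRingWithAct gT [set: gT] R
    (@TotalAction gT R (fun x _ => x) (fun _ => erefl) (fun _ _ _ => erefl))
    (fun _ _ _ _ => erefl) (fun _ _ => (erefl, fun _ _ => erefl)).

Arguments gring_act_monoid [gT D] {g0} [g] _.

Section EquivariantFunctions.

Variables (gT : finGroupType) (D : {set gT}) (X : finType) (to : action D X).
Variable R : gring D.

Definition eqfun_pred : {pred {ffun X -> R}} :=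
  fun f => [forall x, forall g in D, f (to x g) == gring_act R (f x) g].

Lemma eqfun_predP (f : {ffun X -> R}) :
  reflect (forall x g, g \in D -> f (to x g) = gring_act R (f x) g)
          (f \in eqfun_pred).
Proof.
apply: (iffP forallP) => [h x g Dg|h x].
  by have /forall_inP/(_ g Dg)/eqP := h x.
by apply/forall_inP => g Dg; apply/eqP/h.
Qed.

Fact eqfun_subring : subring_closed eqfun_pred.
Proof.
split=> [|f1 f2 /eqfun_predP h1 /eqfun_predP h2|f1 f2 /eqfun_predP h1 /eqfun_predP h2];
  apply/eqfun_predP => x g Dg; rewrite !ffunE.
- by rewrite (gring_act_monoid Dg).1.
- by rewrite h1 // h2 // (gring_act_zmod Dg).
- by rewrite h1 // h2 // (gring_act_monoid Dg).2.
Qed.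
HB.instance Definition _ :=
  GRing.isSubringClosed.Build {ffun X -> R} eqfun_pred eqfun_subring.

Record eqfun := EqFun {
  eqfun_val :> {ffun X -> R};
  eqfun_valP : eqfun_val \in eqfun_pred }.

HB.instance Definition _ := [isSub for eqfun_val].
HB.instance Definition _ := [Choice of eqfun by <:].
HB.instance Definition _ := 
  GRing.SubChoice_isSubPzRing.Build _ _ eqfun eqfun_subring.

Fact eqfun_mulC : @commutative eqfun eqfun *%R.
Proof. by move=> f1 f2; apply/val_inj/ffunP => x; rewrite !ffunE mulrC. Qed.
HB.instance Definition _ :=
  GRing.PzRing_hasCommutativeMul.Build eqfun eqfun_mulC.

Lemma eqfun_equiv (f : eqfun) x g :
  g \in D -> f (to x g) = gring_act R (f x) g.
Proof. by move=> Dg; apply: (eqfun_predP _ (eqfun_valP f)). Qed.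

Lemma eqfunP (f1 f2 : eqfun) : f1 =1 f2 -> f1 = f2.
Proof. by move=> e; apply/val_inj/ffunP. Qed.

End EquivariantFunctions.

Arguments eqfun_pred [gT D X] to R _.

Lemma pullback_fibre (gT : finGroupType) (X Y Y' W : gset gT)
    (f : gmap X Y) (g : gmap Y' Y) (f' : gmap W Y') (g' : gmap W X)
    (T : Type) (idx : T) (op : Monoid.com_law idx) (F : X -> T) y' :
  is_pullback f g f' g' ->
  \big[op/idx]_(x | f x == g y') F x = \big[op/idx]_(w | f' w == y') F (g' w).
Proof.
move=> [comm uniq].
pose h' x := [pick w | (g' w == x) && (f' w == y')].
rewrite (reindex_omap g' h') => [|x /eqP e]; last first.
  rewrite /h'; case: pickP => [w /andP[/eqP <- _]|no] //=.
  have [w [[e1 e2] _]] := uniq _ _ e.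
  by have := no w; rewrite e1 e2 !eqxx.
apply: eq_bigl => w; rewrite comm /h'.
apply/andP/idP => [[_]|/eqP e].
  by case: pickP => [w' /andP[_ e] /eqP[<-]|].
rewrite e eqxx; split=> //; case: pickP => [w' /andP[/eqP e1 /eqP e2]|no].
  have [|w0 [_ u]] := uniq (g' w) y'; first by rewrite comm e.
  by rewrite -(u w') // -(u w).
by have := no w; rewrite e !eqxx.
Qed.

(* The fixed-point Tambara functor of R: its value at X is the ring of
   equivariant functions X -> R. Evaluation at the base coset identifies its
   value at G/H with R^H; evaluation at 1 identifies that at G/e with R.      *)
Section FixedPoint.

Variables (gT : finGroupType) (R : gring [set: gT]).

Implicit Types X Y Z W A B P : gset gT.

Definition fixlevel (X : gset gT) : comPzRingType := eqfun (gset_act X) R.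

Let actD g : zmod_morphism (gring_act R ^~ g) := gring_act_zmod (in_setT g).
Let actM g : monoid_morphism (gring_act R ^~ g) := gring_act_monoid (in_setT g).

Lemma act_sum (I : finType) (P : pred I) (F : I -> R) g :
  gring_act R (\sum_(i | P i) F i) g = \sum_(i | P i) gring_act R (F i) g.
Proof.
have act0 : gring_act R 0 g = 0 by have := actD g 0 0; rewrite !subrr.
have actN x : gring_act R (- x) g = - gring_act R x g.
  by have := actD g 0 x; rewrite act0 !sub0r.
have actA x y : gring_act R (x + y) g = gring_act R x g + gring_act R y g.
  by have := actD g x (- y); rewrite actN !opprK.
by rewrite (big_morph (gring_act R ^~ g) actA act0).
Qed.

Lemma act_prod (I : finType) (P : pred I) (F : I -> R) g :
  gring_act R (\prod_(i | P i) F i) g = \prod_(i | P i) gring_act R (F i) g.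
Proof. by rewrite (big_morph (gring_act R ^~ g) (actM g).2 (actM g).1). Qed.

Section Operations.

Variables (X Y : gset gT) (f : gmap X Y).

Lemma fibre_act (T : Type) (idx : T) (op : Monoid.com_law idx) (F : X -> T) y g :
  \big[op/idx]_(x | f x == gset_act Y y g) F x
    = \big[op/idx]_(x | f x == y) F (gset_act X x g).
Proof.
rewrite (reindex_inj (act_inj (gset_act X) g)).
by apply: eq_bigl => x; rewrite gmap_equiv (inj_eq (act_inj _ g)).
Qed.

Fact fixres_subproof (a : fixlevel Y) :
  [ffun x => a (f x)] \in eqfun_pred (gset_act X) R.
Proof. by apply/eqfun_predP => x g Dg; rewrite !ffunE gmap_equiv eqfun_equiv. Qed.
Definition fixres (a : fixlevel Y) : fixlevel X := EqFun (fixres_subproof a).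

Fact fixtr_subproof (a : fixlevel X) :
  [ffun y => \sum_(x | f x == y) a x] \in eqfun_pred (gset_act Y) R.
Proof.
apply/eqfun_predP => y g Dg; rewrite !ffunE fibre_act act_sum.
by apply: eq_bigr => x _; rewrite eqfun_equiv.
Qed.
Definition fixtr (a : fixlevel X) : fixlevel Y := EqFun (fixtr_subproof a).

Fact fixnm_subproof (a : fixlevel X) :
  [ffun y => \prod_(x | f x == y) a x] \in eqfun_pred (gset_act Y) R.
Proof.
apply/eqfun_predP => y g Dg; rewrite !ffunE fibre_act act_prod.
by apply: eq_bigr => x _; rewrite eqfun_equiv.
Qed.
Definition fixnm (a : fixlevel X) : fixlevel Y := EqFun (fixnm_subproof a).

End Operations.

Fact fixres_zmod X Y (f : gmap X Y) : zmod_morphism (fixres f).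
Proof. by move=> a b; apply: eqfunP => x; rewrite !ffunE. Qed.

Fact fixres_monoid X Y (f : gmap X Y) : monoid_morphism (fixres f).
Proof. by split=> [|a b]; apply: eqfunP => x; rewrite !ffunE. Qed.

Fact fixtr_zmod X Y (f : gmap X Y) : zmod_morphism (fixtr f).
Proof.
move=> a b; apply: eqfunP => y; rewrite !ffunE -sumrB.
by apply: eq_bigr => x _; rewrite !ffunE.
Qed.

Fact fixnm_monoid X Y (f : gmap X Y) : monoid_morphism (fixnm f).
Proof.
split=> [|a b]; apply: eqfunP => y; rewrite !ffunE.
  by apply: big1 => x _; rewrite ffunE.
by rewrite -big_split; apply: eq_bigr => x _; rewrite !ffunE.
Qed.

Fact fixres_id X : fixres (gmap_id X) =1 id.
Proof. by move=> a; apply: eqfunP => x; rewrite !ffunE. Qed.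

Fact fixtr_id X : fixtr (gmap_id X) =1 id.
Proof. by move=> a; apply: eqfunP => x; rewrite !ffunE /= big_pred1_eq. Qed.

Fact fixnm_id X : fixnm (gmap_id X) =1 id.
Proof. by move=> a; apply: eqfunP => x; rewrite !ffunE /= big_pred1_eq. Qed.

Fact fixres_comp X Y Z (g : gmap Y Z) (f : gmap X Y) :
  fixres (gmap_comp g f) =1 fixres f \o fixres g.
Proof. by move=> a; apply: eqfunP => x; rewrite !ffunE. Qed.

Lemma fibre_comp (X Y Z : gset gT) (g : gmap Y Z) (f : gmap X Y)
    (T : Type) (idx : T) (op : Monoid.com_law idx) (F : X -> T) z :
  \big[op/idx]_(x | gmap_comp g f x == z) F x =
  \big[op/idx]_(y | g y == z) \big[op/idx]_(x | f x == y) F x.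
Proof.
rewrite (partition_big f (fun y => g y == z)) //=.
by apply: eq_bigr => y /eqP <-; apply: eq_bigl => x /=; apply: andb_idl => /eqP ->.
Qed.

Fact fixtr_comp X Y Z (g : gmap Y Z) (f : gmap X Y) :
  fixtr (gmap_comp g f) =1 fixtr g \o fixtr f.
Proof.
move=> a; apply: eqfunP => z; rewrite !ffunE fibre_comp.
by apply: eq_bigr => y _; rewrite ffunE.
Qed.

Fact fixnm_comp X Y Z (g : gmap Y Z) (f : gmap X Y) :
  fixnm (gmap_comp g f) =1 fixnm g \o fixnm f.
Proof.
move=> a; apply: eqfunP => z; rewrite !ffunE fibre_comp.
by apply: eq_bigr => y _; rewrite ffunE.
Qed.

Fact fix_empty X : #|X| = 0%N -> forall a : fixlevel X, a = 0.
Proof. by move=> /card0_eq X0 a; apply: eqfunP => x; have := X0 x. Qed.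

Fact fix_coproduct X Y Z (i : gmap X Z) (j : gmap Y Z) :
  is_coproduct i j ->
  bijective (fun a : fixlevel Z => (fixres i a, fixres j a)).
Proof.
move=> [h hK Kh].
have iK x : h (i x) = inl x by have := hK (inl x).
have jK y : h (j y) = inr y by have := hK (inr y).
pose v (ab : fixlevel X * fixlevel Y) : {ffun Z -> R} :=
  [ffun z => match h z with inl x => ab.1 x | inr y => ab.2 y end].
have vP ab : v ab \in eqfun_pred (gset_act Z) R.
  apply/eqfun_predP => z g Dg; rewrite !ffunE -[z in LHS]Kh.
  case: (h z) => [x|y]; rewrite -gmap_equiv ?iK ?jK; exact: eqfun_equiv.
exists (fun ab => EqFun (vP ab)) => [a|[a b]].
  apply: eqfunP => z; rewrite !ffunE -[z in RHS]Kh.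
  by case: (h z) => x; rewrite ffunE.
by congr pair; apply: eqfunP => x; rewrite !ffunE ?iK ?jK.
Qed.

Fact fixtr_pullback X Y Y' W (f : gmap X Y) (g : gmap Y' Y)
    (f' : gmap W Y') (g' : gmap W X) :
  is_pullback f g f' g' -> fixres g \o fixtr f =1 fixtr f' \o fixres g'.
Proof.
move=> pb a; apply: eqfunP => y'; rewrite !ffunE (pullback_fibre _ _ _ pb).
by apply: eq_bigr => w _; rewrite ffunE.
Qed.

Fact fixnm_pullback X Y Y' W (f : gmap X Y) (g : gmap Y' Y)
    (f' : gmap W Y') (g' : gmap W X) :
  is_pullback f g f' g' -> fixres g \o fixnm f =1 fixnm f' \o fixres g'.
Proof.
move=> pb a; apply: eqfunP => y'; rewrite !ffunE (pullback_fibre _ _ _ pb).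
by apply: eq_bigr => w _; rewrite ffunE.
Qed.

Fact fixnm_tr A X Y P B (q : gmap A X) (f : gmap X Y)
    (e : gmap B A) (f' : gmap B P) (r : gmap P Y) :
  is_exponential q f e f' r ->
  fixnm f \o fixtr q =1 fixtr r \o fixnm f' \o fixres e.
Proof.
move=> [pb sect] a; apply: eqfunP => y; rewrite !ffunE.
under eq_bigr => x _ do rewrite ffunE.
have [comm uniq] := pb.
pose Xy := {x in [pred x | f x == y]}; pose Py := {c in [pred c | r c == y]}.
have uniqB b b' : f' b = f' b' -> q (e b) = q (e b') -> b = b'.
  move=> e1 e2; have [w [_ u]] := uniq _ _ (comm b).
  by rewrite -(u b) // -(u b') //= e1 e2.
have exb (c : Py) (x : Xy) : exists b, (f' b == val c) && (q (e b) == val x).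
  have [|b [[e1 e2] _]] := uniq (val x) (val c).
    by rewrite (eqP (valP x)) (eqP (valP c)).
  by exists b; rewrite e2 -e1 /= !eqxx.
pose sec c x := xchoose (exb c x).
have f'sec c x : f' (sec c x) = val c.
  by have /andP[/eqP] := xchooseP (exb c x).
have qsec c x : q (e (sec c x)) = val x.
  by have /andP[_ /eqP] := xchooseP (exb c x).
pose h c : {ffun Xy -> A} := [ffun x => e (sec c x)].
have hfibre c b (x : Xy) : f' b = val c -> q (e b) = val x -> e b = h c x.
  move=> e1 e2; rewrite ffunE; congr (e _).
  by apply: uniqB; rewrite ?f'sec ?qsec.
have h_inj : injective h.
  move=> c c' ecc'.
  have [|c0 [_ u]] := sect y (fun x => h c (Sub (val x) (valP x))).
    by move=> x; rewrite ffunE qsec.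
  apply: val_inj; rewrite -(u (val c)).
    apply: u; split=> [|b x e1 e2]; first exact/eqP/(valP c').
    by rewrite ecc'; apply: hfibre.
  split=> [|b x e1 e2]; first exact/eqP/(valP c).
  exact: hfibre.
rewrite (big_sub [pred x | f x == y]) /= bigA_distr_big_dep.
rewrite (reindex_omap h (fun s => [pick c | h c == s])) /=; last first.
  move=> s /familyP sq; case: pickP => [c /eqP <-//|no].
  have [|c [[rc cs] _]] := sect y (fun x => s (Sub (val x) (valP x))).
    by move=> x; have /eqP := sq (Sub (val x) (valP x)).
  have := no (Sub c (introT eqP rc)); case/eqP; apply/ffunP => x.
  rewrite ffunE (cs _ (Sub (val x) (valP x))) ?f'sec ?qsec //.
  by congr (s _); apply: val_inj.
rewrite (big_sub [pred c | r c == y]) /=.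
apply: eq_big => [c|c _].
  apply/andP; split.
    by apply/familyP => x; rewrite ffunE unfold_in /= qsec.
  by case: pickP => [c' /eqP/h_inj->//|/(_ c)]; rewrite eqxx.
rewrite !ffunE (reindex_omap (sec c) (fun b => insub (q (e b)))) /=; last first.
  move=> b /eqP e1; rewrite insubT /=.
    by rewrite inE -[f _]/(f (gmap_comp q e b)) comm e1; apply: (valP c).
  by move=> m; congr Some; apply: uniqB; rewrite ?f'sec ?qsec.
apply: eq_big => [x|x _]; last by rewrite !ffunE.
by rewrite f'sec qsec valK !eqxx.
Qed.

Definition fixed_tambara : tambara gT :=
  Tambara fixres_zmod fixres_monoid fixtr_zmod fixnm_monoid fixres_id fixtr_id
    fixnm_id fixres_comp fixtr_comp fixnm_comp fix_empty fix_coproduct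
    fixtr_pullback fixnm_pullback fixnm_tr.

End FixedPoint.

(* A sub-Tambara functor is a family of subrings closed under res, tr and nm;
   closure under finite products of G-sets is automatic:
   an element of k(X + Y) is the sum of the transfers of its restrictions.    *)
Section SubTambara.

Variables (gT : finGroupType) (k : tambara gT).
Implicit Types X Y Z W A B P : gset gT.

Record subtambara := SubTambara {
  sub_level : forall X, subringClosed (k X);
  sub_res : forall X Y (f : gmap X Y) (a : k Y),
    a \in sub_level Y -> res f a \in sub_level X;
  sub_tr : forall X Y (f : gmap X Y) (a : k X),
    a \in sub_level X -> tr f a \in sub_level Y;
  sub_nm : forall X Y (f : gmap X Y) (a : k X),
    a \in sub_level X -> nm f a \in sub_level Y }.

Variable S : subtambara.

Record sublevel (X : gset gT) := SubLevel {
  sublevel_val :> k X;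
  sublevel_valP : sublevel_val \in sub_level S X }.

Section Level.
Variable X : gset gT.
HB.instance Definition _ := [isSub for @sublevel_val X].
HB.instance Definition _ := [Choice of sublevel X by <:].
HB.instance Definition _ :=
  GRing.SubChoice_isSubComPzRing.Build _ _ (sublevel X)
    (GRing.subringClosedP (sub_level S X)).
End Level.

Definition subres X Y (f : gmap X Y) (a : sublevel Y) : sublevel X :=
  SubLevel (sub_res f (sublevel_valP a)).
Definition subtr X Y (f : gmap X Y) (a : sublevel X) : sublevel Y :=
  SubLevel (sub_tr f (sublevel_valP a)).
Definition subnm X Y (f : gmap X Y) (a : sublevel X) : sublevel Y :=
  SubLevel (sub_nm f (sublevel_valP a)).

Fact subres_zmod X Y (f : gmap X Y) : zmod_morphism (subres f).
Proof. by move=> a b; apply/val_inj/res_zmod. Qed.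

Fact subres_monoid X Y (f : gmap X Y) : monoid_morphism (subres f).
Proof.
by split=> [|a b]; apply: val_inj; [apply: (res_monoid k f).1 | apply: (res_monoid k f).2].
Qed.

Fact subtr_zmod X Y (f : gmap X Y) : zmod_morphism (subtr f).
Proof. by move=> a b; apply/val_inj/tr_zmod. Qed.

Fact subnm_monoid X Y (f : gmap X Y) : monoid_morphism (subnm f).
Proof.
by split=> [|a b]; apply: val_inj; [apply: (nm_monoid k f).1 | apply: (nm_monoid k f).2].
Qed.

Fact subres_id X : subres (gmap_id X) =1 id.
Proof. by move=> a; apply/val_inj/res_id. Qed.

Fact subtr_id X : subtr (gmap_id X) =1 id.
Proof. by move=> a; apply/val_inj/tr_id. Qed.

Fact subnm_id X : subnm (gmap_id X) =1 id.
Proof. by move=> a; apply/val_inj/nm_id. Qed.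

Fact subres_comp X Y Z (g : gmap Y Z) (f : gmap X Y) :
  subres (gmap_comp g f) =1 subres f \o subres g.
Proof. by move=> a; apply/val_inj/res_comp. Qed.

Fact subtr_comp X Y Z (g : gmap Y Z) (f : gmap X Y) :
  subtr (gmap_comp g f) =1 subtr g \o subtr f.
Proof. by move=> a; apply/val_inj/tr_comp. Qed.

Fact subnm_comp X Y Z (g : gmap Y Z) (f : gmap X Y) :
  subnm (gmap_comp g f) =1 subnm g \o subnm f.
Proof. by move=> a; apply/val_inj/nm_comp. Qed.

Fact sub_empty X : #|X| = 0%N -> forall a : sublevel X, a = 0.
Proof. by move=> X0 a; apply/val_inj/level_empty. Qed.

Fact sub_coproduct X Y Z (i : gmap X Z) (j : gmap Y Z) :
  is_coproduct i j -> bijective (fun a : sublevel Z => (subres i a, subres j a)).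
Proof.
move=> ij; have [h hK _] := level_coproduct k ij.
have hinj : injective (fun s : X + Y => match s with inl x => i x | inr y => j y end).
  exact: bij_inj ij.
have rii (a : k X) : res i (tr i a) = a.
  have pb : is_pullback i i (gmap_id X) (gmap_id X).
    split=> // x x' e; have [->] := hinj (inl x) (inl x') e.
    by exists x'; split=> // w [].
  by have /= -> := tr_pullback pb a; rewrite res_id tr_id.
have rjj (b : k Y) : res j (tr j b) = b.
  have pb : is_pullback j j (gmap_id Y) (gmap_id Y).
    split=> // x x' e; have [->] := hinj (inr x) (inr x') e.
    by exists x'; split=> // w [].
  by have /= -> := tr_pullback pb b; rewrite res_id tr_id.
have tr0 U V (f : gmap U V) : tr f (0 : k U) = 0.
  by have := tr_zmod f (0 : k U) 0; rewrite !subrr.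
pose E : gset gT := GSet (TotalAction (fun x : void => erefl)
  (fun (x : void) (_ _ : gT) => erefl)).
pose u U : gmap E U := @GMap gT E U (of_void U) (fun x => match x with end).
have E0 : #|E| = 0%N by rewrite card_void.
have rij (b : k Y) : res i (tr j b) = 0.
  have pb : is_pullback j i (u X) (u Y).
    by split=> [[]|y x e]; have := hinj (inl x) (inr y) (esym e).
  by have /= -> := tr_pullback pb b; rewrite (level_empty E0 (res _ _)) tr0.
have rji (a : k X) : res j (tr i a) = 0.
  have pb : is_pullback i j (u Y) (u X).
    by split=> [[]|x y e]; have := hinj (inl x) (inr y) e.
  by have /= -> := tr_pullback pb a; rewrite (level_empty E0 (res _ _)) tr0.
have rD U V (f : gmap U V) (a b : k V) : res f (a + b) = res f a + res f b.
  have r0 : res f (0 : k V) = 0 by have := res_zmod f (0 : k V) 0; rewrite !subrr.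
  have rN c : res f (- c : k V) = - res f c.
    by have := res_zmod f (0 : k V) c; rewrite r0 !sub0r.
  by have := res_zmod f a (- b); rewrite rN !opprK.
exists (fun ab => subtr i ab.1 + subtr j ab.2) => [a|[a b]].
  apply: val_inj; apply: (can_inj hK); rewrite /=.
  by rewrite !rD rii rjj rij rji addr0 add0r.
by congr pair; apply: val_inj; rewrite /= rD ?rii ?rjj ?rij ?rji ?addr0 ?add0r.
Qed.

Fact subtr_pullback X Y Y' W (f : gmap X Y) (g : gmap Y' Y)
    (f' : gmap W Y') (g' : gmap W X) :
  is_pullback f g f' g' -> subres g \o subtr f =1 subtr f' \o subres g'.
Proof. by move=> pb a; apply: val_inj; apply: (tr_pullback pb). Qed.

Fact subnm_pullback X Y Y' W (f : gmap X Y) (g : gmap Y' Y)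
    (f' : gmap W Y') (g' : gmap W X) :
  is_pullback f g f' g' -> subres g \o subnm f =1 subnm f' \o subres g'.
Proof. by move=> pb a; apply: val_inj; apply: (nm_pullback pb). Qed.

Fact subnm_tr A X Y P B (q : gmap A X) (f : gmap X Y)
    (e : gmap B A) (f' : gmap B P) (r : gmap P Y) :
  is_exponential q f e f' r ->
  subnm f \o subtr q =1 subtr r \o subnm f' \o subres e.
Proof. by move=> ex a; apply: val_inj; apply: (nm_tr ex). Qed.

Definition sub_tambara : tambara gT :=
  Tambara subres_zmod subres_monoid subtr_zmod subnm_monoid subres_id subtr_id
    subnm_id subres_comp subtr_comp subnm_comp sub_empty sub_coproduct
    subtr_pullback subnm_pullback subnm_tr.

End SubTambara.

Section Bottom.

Variables (gT : finGroupType) (k : tambara gT).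

(* G acts on k(G/e) by restriction along the automorphisms x |-> g x.         *)
Definition bottom_act (a : k (free_orbit gT)) (g : gT) : k (free_orbit gT) :=
  res (ltrans g) a.

Fact bottom_act1 : bottom_act^~ 1%g =1 id.
Proof.
move=> a; rewrite /bottom_act -[RHS](res_id (X := free_orbit gT)).
by congr (res _ a); apply: gmapP => x /=; rewrite mul1g.
Qed.

Fact bottom_actM a : act_morph bottom_act a.
Proof.
move=> g h; rewrite /bottom_act -[RHS]/((res (ltrans h) \o res (ltrans g)) a).
rewrite -res_comp; congr (res _ a); apply: gmapP => x /=; exact/esym/mulgA.
Qed.

Definition bottom : gring [set: gT] :=
  @GRingWithAct gT [set: gT] (k (free_orbit gT))
    (TotalAction bottom_act1 bottom_actM)
    (fun g _ => res_zmod (ltrans g)) (fun g _ => res_monoid k (ltrans g)).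

End Bottom.

(* Coind_H^G R is the ring of H-equivariant functions G -> R, where H acts on
   G by right translation; a choice of representatives of the cosets g H
   identifies it with Fun(G/H, R).                                            *)
Section Coinduction.

Variables (gT : finGroupType) (H : {group gT}) (R : gring H).

Definition coind_ring : comPzRingType :=
  eqfun ('R \ subsetT H)%act R.

Fact coind_act_subproof (a : coind_ring) (g : gT) :
  [ffun x => a (g * x)%g] \in eqfun_pred ('R \ subsetT H)%act R.
Proof.
apply/eqfun_predP => x h Hh; rewrite !ffunE /= mulgA.
exact: (eqfun_equiv a (g * x)%g Hh).
Qed.
Definition coind_act (a : coind_ring) (g : gT) : coind_ring :=
  EqFun (coind_act_subproof a g).

Fact coind_act1 : coind_act^~ 1%g =1 id.
Proof. by move=> a; apply: eqfunP => x; rewrite ffunE mul1g. Qed.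

Fact coind_actM a : act_morph coind_act a.
Proof. by move=> g h; apply: eqfunP => x; rewrite !ffunE mulgA. Qed.

Fact coind_act_zmod g : g \in [set: gT] -> zmod_morphism (coind_act^~ g).
Proof. by move=> _ a b; apply: eqfunP => x; rewrite !ffunE. Qed.

Fact coind_act_monoid g : g \in [set: gT] -> monoid_morphism (coind_act^~ g).
Proof. by move=> _; split=> [|a b]; apply: eqfunP => x; rewrite !ffunE. Qed.

Definition coind : gring [set: gT] :=
  @GRingWithAct gT [set: gT] coind_ring (TotalAction coind_act1 coind_actM)
    coind_act_zmod coind_act_monoid.

End Coinduction.

Definition separated (gT : finGroupType) (k : tambara gT) : Prop :=
  exists (H : {group gT}) (R : gring H),
    H \proper [set: gT] /\ gring_iso (bottom k) (coind R).

Definition clarified (gT : finGroupType) (k : tambara gT) : Prop :=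
  ~ separated k.

Definition trivial_bottom (gT : finGroupType) (k : tambara gT) : Prop :=
  forall (a : bottom k) (g : gT), gring_act (bottom k) a g = a.

(* MathComp's [pchar R] is restricted to nonzero rings; levels may be zero.   *)
Definition has_char (R : pzRingType) (n : nat) : Prop :=
  forall m : nat, m%:R = 0 :> R <-> (n %| m)%N.

Definition is_field (R : comPzRingType) : Prop :=
  1 <> 0 :> R /\ forall x : R, x <> 0 -> exists y, x * y = 1.

Definition is_subfield (R : comPzRingType) (E : R -> Prop) : Prop :=
  [/\ E 1, forall x y, E x -> E y -> E (x - y),
      forall x y, E x -> E y -> E (x * y) &
      forall x, E x -> x <> 0 -> exists2 y, E y & x * y = 1].

Definition res_top (gT : finGroupType) (k : tambara gT) :
    k (point gT) -> k (free_orbit gT) :=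
  res (to_point (free_orbit gT)).

Definition tambara_iso (gT : finGroupType) (k l : tambara gT) (f : tmor k l) : Prop :=
  forall X, bijective (f X).

(* S has bottom level R and top level E, inside the fixed-point functor of the
   ring R with trivial action, whose top level is R by evaluation.            *)
Definition has_levels (gT : finGroupType) (R : comPzRingType) (E : R -> Prop)
    (S : subtambara (fixed_tambara (trivial_gring gT R))) : Prop :=
  (forall a : fixed_tambara (trivial_gring gT R) (free_orbit gT),
     a \in sub_level S (free_orbit gT)) /\
  (forall a : fixed_tambara (trivial_gring gT R) (point gT),
     a \in sub_level S (point gT) <-> E (a tt)).

(* Main.v *)
Require Import Defs.
From HB Require Import structures.
From mathcomp Require Import all_boot all_fingroup all_algebra all_solvable.
From mathcomp Require Import boolp.

(** Let [G] have prime order [p]. Everything is read off at the bottom level.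
For [x : X] let [orbit_map x : G/e -> X] be the map [g |-> x g]. Pulling a
transfer or a norm back along such a map turns it into a sum or a product of
restrictions ([res_orbit_tr], [res_orbit_nm]), because a pullback along
[orbit_map x] is a finite disjoint union of copies of [G/e]. Hence every
equivariant ring morphism [psi] from the bottom level to a [G]-ring [R] extends
to a morphism from [k] to the fixed-point functor of [R]: it sends [a : k X] to
the function [x |-> psi (res (orbit_map x) a)] ([comparison]).

From [k] to the data. A monic morphism is levelwise injective: test it against
its kernel pair ([monic_injective]). So for field-like [k] every comparison with
a nonzero target is injective. Apply this twice.
- If [x] at the bottom level is not a unit, let [psi] be the quotient by the
  ideal [(x)], which is invariant as the action is trivial. The comparison kills
  [x], so [x = 0]: the bottom level is a field [F] ([trivial_bottom_field]).
- If [psi] is the identity of [F], the comparison embeds [k] into the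
  fixed-point functor of [F]. On the top level it is the restriction map, so the
  latter is injective. Its image is the desired subfunctor. The restriction of
  the norm of [x : F] is [x ^+ p], whence the top level contains the image of
  Frobenius. It is then closed under inverses, as [1 / x = (1 / x) ^+ p * x ^+ (p - 1)].

From the data to [k]. Given [E] in [F], let the subfunctor consist of the
functions that take values in [E] at the fixed points of [X]. It is closed under
transfers and norms because a fibre over a fixed point splits into fixed points
and free orbits, on which an invariant function contributes [x *+ p = 0] to a sum
and [x ^+ p] to a product ([invariant_bigop]). It is the only one with the given
levels, since membership of an element in a subfunctor can be tested on the
orbits of [X], each of which is [G/e] or [G/G] ([sub_level_orbits]). It is
field-like: an element that a morphism to [l] kills restricts, if nonzero, to a
unit of the bottom level, so the bottom level of [l] is zero; then so is [l],
because [1 = nm 1 = nm 0 = 0] at its top level ([zero_from_free]). It is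
clarified because the action on a nonzero coinduced ring moves the indicator
function of the subgroup ([trivial_bottom_clarified]). *)

Set Implicit Arguments.
Unset Strict Implicit.
Unset Printing Implicit Defensive.

Import GroupScope GRing.Theory.
Local Open Scope ring_scope.

(** * Orbits of finite G-sets *)

Section FiniteGSets.

Variable gT : finGroupType.
Implicit Types X Y Z : gset gT.

Definition orbit_map X (x : X) : gmap (free_orbit gT) X :=
  @GMap gT (free_orbit gT) X (gset_act X x) (fun g h => actM (gset_act X) x g h).

Lemma gmap_comp_orbit_map X Y (f : gmap X Y) (x : X) :
  gmap_comp f (orbit_map x) = orbit_map (f x).
Proof. by apply: gmapP => g /=; rewrite gmap_equiv. Qed.

Lemma orbit_map_act X (x : X) g :
  orbit_map (gset_act X x g) = gmap_comp (orbit_map x) (ltrans g).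
Proof. by apply: gmapP => h /=; rewrite actM. Qed.

Lemma orbit_map_free (g : gT) : orbit_map (g : free_orbit gT) = ltrans g.
Proof. exact: gmapP. Qed.

Lemma orbit_map_point : orbit_map (tt : point gT) = to_point (free_orbit gT).
Proof. exact: gmapP. Qed.

Definition fixed_point X (x : X) := forall g, gset_act X x g = x.

Definition point_map X (x : X) (xfix : fixed_point x) : gmap (point gT) X :=
  @GMap gT (point gT) X (fun=> x) (fun _ g => esym (xfix g)).

Section SubGSet.

Variables (X : gset gT) (P : pred X).
Hypothesis Pact : forall x g, P x -> P (gset_act X x g).

Definition sub_act (x : {x | P x}) (g : gT) : {x | P x} :=
  Sub (gset_act X (val x) g) (Pact g (valP x)).

Fact sub_act1 : sub_act^~ 1%g =1 id.
Proof. by move=> x; apply: val_inj; rewrite /= act1. Qed.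

Fact sub_actM x : act_morph sub_act x.
Proof. by move=> g h; apply: val_inj; rewrite /= actM. Qed.

Definition sub_gset : gset gT := GSet (TotalAction sub_act1 sub_actM).

Definition sub_incl : gmap sub_gset X :=
  @GMap gT sub_gset X (fun x => val x) (fun _ _ => erefl).

End SubGSet.

Section Complement.

Variables (X Z : gset gT) (i : gmap X Z).

Fact compl_act z g : z \notin codom i -> gset_act Z z g \notin codom i.
Proof.
apply: contra => /codomP[x /(congr1 (fun y => gset_act Z y g^-1%g))].
by rewrite actK -gmap_equiv => ->; apply: codom_f.
Qed.

Definition compl_gset := sub_gset compl_act.
Definition compl_incl : gmap compl_gset Z := sub_incl compl_act.

Lemma compl_coproduct : injective i -> is_coproduct i compl_incl.
Proof.
move=> i_inj; apply: inj_card_bij => [[x|y] [x'|y'] /=|].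
- by move/i_inj->.
- by move=> e; case/negP: (valP y'); rewrite /= -e codom_f.
- by move=> e; case/negP: (valP y); rewrite /= e codom_f.
- by move/val_inj->.
rewrite card_sum card_sig -(card_codom i_inj) addnC.
by rewrite -(cardC (mem (codom i))) addnC.
Qed.

Lemma card_compl : injective i -> (0 < #|X|)%N -> (#|compl_gset| < #|Z|)%N.
Proof.
move=> i_inj X0; rewrite card_sig -(cardC (mem (codom i))) card_codom //.
by rewrite -[ltnLHS]add0n ltn_add2r.
Qed.

End Complement.

Lemma card_free_orbit_gt0 : (0 < #|free_orbit gT|)%N.
Proof. by apply/card_gt0P; exists 1%g. Qed.

Lemma card_point_gt0 : (0 < #|point gT|)%N.
Proof. by rewrite card_unit. Qed.

Definition empty_gset : gset gT :=
  GSet (TotalAction (fun x : void => erefl) (fun (x : void) (_ _ : gT) => erefl)).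

Lemma card_empty_gset : #|empty_gset| = 0%N.
Proof. exact: card_void. Qed.

Definition from_empty X : gmap empty_gset X :=
  @GMap gT empty_gset X (of_void X) (fun x => match x with end).

Section PrimeOrder.

Hypothesis prime_order : prime #|[set: gT]|.

(** The size of an orbit divides the prime order of the group, so it is 1 or
    maximal. *)
Lemma orbit_dichotomy X (x : X) : fixed_point x \/ injective (orbit_map x).
Proof.
have /(primeP prime_order).2 := dvdn_orbit (gset_act X) [set: gT]%G x.
case/orP => [/cards1P[y oy]|/eqP cardo]; [left=> g | right].
  have xy : x \in [set y] by rewrite -oy orbit_refl.
  have : gset_act X x g \in [set y] by rewrite -oy mem_orbit ?inE.
  by move: xy; rewrite !inE => /eqP-> /eqP.
by have /imset_injP inj_x := introT eqP cardo; move=> g h; apply: inj_x; rewrite inE.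
Qed.

(** Splitting off one orbit at a time: only the two orbits [G/e] and [G/G] can
    occur. *)
Lemma gset_orbit_ind (P : gset gT -> Prop) :
  (forall X, #|X| = 0%N -> P X) ->
  (forall X Z (i : gmap (free_orbit gT) Z) (j : gmap X Z),
     is_coproduct i j -> P X -> P Z) ->
  (forall X Z (i : gmap (point gT) Z) (j : gmap X Z),
     is_coproduct i j -> P X -> P Z) ->
  forall X, P X.
Proof.
move=> P0 Pfree Ppoint X.
have [n] := ubnP #|X|; elim: n X => // n IHn X; rewrite ltnS => leXn.
have [|/card_gt0P[x _]] := posnP #|X|; first exact: P0.
have [xfix|oinj] := orbit_dichotomy x.
  have pinj : injective (point_map xfix) by move=> [] [].
  apply: Ppoint (compl_coproduct pinj) (IHn _ (leq_trans _ leXn)).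
  exact: card_compl card_point_gt0.
apply: Pfree (compl_coproduct oinj) (IHn _ (leq_trans _ leXn)).
exact: card_compl card_free_orbit_gt0.
Qed.

End PrimeOrder.

End FiniteGSets.

(** * Transfers and norms seen from the bottom level *)

Lemma zmod_morph0 (U V : zmodType) (f : U -> V) : zmod_morphism f -> f 0 = 0.
Proof. by move=> fB; have := fB 0 0; rewrite !subrr. Qed.

Lemma zmod_morphD (U V : zmodType) (f : U -> V) :
  zmod_morphism f -> {morph f : a b / a + b}.
Proof.
move=> fB a b; have := fB (a + b) b; rewrite addrK => ->.
by rewrite subrK.
Qed.

(** Transfers and norms obey the same functoriality and base change laws, with
    sums in one case and products in the other. Here [push] stands for either,
    and [op] for the operation that it respects. *)
Section Pushforward.

Variables (gT : finGroupType) (k : tambara gT).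
Implicit Types X Y Z W : gset gT.

Variables (push : forall X Y, gmap X Y -> k X -> k Y).
Variables (idx : forall X, k X) (op : forall X, Monoid.com_law (idx X)).
Hypothesis push_idx : forall X Y (f : gmap X Y), push f (idx X) = idx Y.
Hypothesis push_op : forall X Y (f : gmap X Y), {morph push f : a b / op X a b >-> op Y a b}.
Hypothesis res_op : forall X Y (f : gmap X Y), {morph res (t := k) f : a b / op Y a b >-> op X a b}.
Hypothesis push_id : forall X, push (gmap_id X) =1 id.
Hypothesis push_comp : forall X Y Z (g : gmap Y Z) (f : gmap X Y),
  push (gmap_comp g f) =1 push g \o push f.
Hypothesis push_pullback : forall X Y Y' W (f : gmap X Y) (g : gmap Y' Y)
    (f' : gmap W Y') (g' : gmap W X),
  is_pullback f g f' g' -> res g \o push f =1 push f' \o res g'.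

Lemma res_push_inj X Z (i : gmap X Z) : injective i -> cancel (push i) (res i).
Proof.
move=> i_inj a.
have pb : is_pullback i i (gmap_id X) (gmap_id X).
  by split=> // x x' /i_inj->; exists x'; split=> // w [].
by have /= -> := push_pullback pb a; rewrite res_id push_id.
Qed.

(** The pullback of two maps with disjoint images is empty, and the level of the
    empty set is the zero ring, where every element equals [idx]. *)
Lemma res_push_disjoint X Y Z (i : gmap X Z) (j : gmap Y Z) :
  (forall x y, i x <> j y) -> forall a, res j (push i a) = idx Y.
Proof.
move=> ij a.
have pb : is_pullback i j (from_empty Y) (from_empty X).
  by split=> [[]|x y /ij].
have /= -> := push_pullback pb a.
have E0 := level_empty (t := k) (card_empty_gset gT).
by rewrite [res _ _]E0 -[0](E0 (idx _)) push_idx.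
Qed.

(** Restriction to the two summands is injective; on each of them one of the two
    factors restricts to the given element and the other to the unit of [op]. *)
Lemma coproduct_split X Y Z (i : gmap X Z) (j : gmap Y Z) :
  is_coproduct i j ->
  forall c, c = op Z (push i (res i c)) (push j (res j c)).
Proof.
move=> ij c; have [h hK _] := level_coproduct k ij.
have inj_s := bij_inj ij.
have i_inj : injective i by move=> x x' e; have [] := inj_s (inl x) (inl x') e.
have j_inj : injective j by move=> x x' e; have [] := inj_s (inr x) (inr x') e.
have dij x y : i x <> j y by move=> e; have := inj_s (inl x) (inr y) e.
apply: (can_inj hK); rewrite !res_op !res_push_inj //.
by rewrite !res_push_disjoint ?Monoid.mulm1 ?Monoid.mul1m // => y x /esym/dij.
Qed.

(** A set over [G/e] is a disjoint union of copies of [G/e], one for each element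
    [w] of the fibre over 1, and on the copy of [w] the composite of [f] with
    [orbit_map w] is the identity. The copies are split off by induction. *)
Lemma push_to_free W (f : gmap W (free_orbit gT)) (c : k W) :
  push f c = \big[op _/idx _]_(w | f w == 1%g) res (orbit_map w) c.
Proof.
have [n] := ubnP #|W|; elim: n W f c => // n IHn W f c; rewrite ltnS => leWn.
have [W0|/card_gt0P[w0 _]] := posnP #|W|.
  rewrite big1 => [|w _]; last by have /card0_eq/(_ w) := W0.
  by rewrite (level_empty W0 c) -[0](level_empty W0 (idx W)) push_idx.
(* Each orbit meets the fibre over 1; move [w0] there. *)
pose w := gset_act W w0 (f w0)^-1%g.
have fw : f w = 1%g by rewrite gmap_equiv /= mulgV.
have fo : gmap_comp f (orbit_map w) = gmap_id _.
  by rewrite gmap_comp_orbit_map fw; apply: gmapP => h /=; rewrite mul1g.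
have oinj : injective (orbit_map w).
  move=> g h /(congr1 f); have /= fo' x : f (orbit_map w x) = x.
    by rewrite -[LHS]/(gmap_comp f (orbit_map w) x) fo.
  by rewrite -!/(orbit_map w _) !fo'.
have cop := compl_coproduct oinj; set j := compl_incl _ in cop.
rewrite {1}(coproduct_split cop c) push_op.
rewrite -![push f (push _ _)]/((push f \o push _) _) -!push_comp fo push_id.
rewrite (IHn _ (gmap_comp f j)); last first.
  exact: leq_trans (card_compl oinj (card_free_orbit_gt0 gT)) leWn.
rewrite [RHS](reindex _ (onW_bij _ cop)) big_sumType /=; congr (op _ _ _).
  rewrite (big_pred1 1%g) => [|g]; first by rewrite act1.
  by rewrite gmap_equiv fw /= mul1g.
apply: eq_bigr => y _.
by rewrite -[LHS]/((res _ \o res _) _) -res_comp gmap_comp_orbit_map.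
Qed.

(** The pullback of [f] along [orbit_map y] is the fibre of [f] at [y] times
    [G/e], the pair [(x, h)] lying over [x h] and over [h]. *)
Lemma res_orbit_push X Y (f : gmap X Y) (a : k X) (y : Y) :
  res (orbit_map y) (push f a) =
    \big[op _/idx _]_(x | f x == y) res (orbit_map x) a.
Proof.
pose I := {x | f x == y}.
pose act (w : I * gT) g : I * gT := (w.1, (w.2 * g)%g).
have actI1 : act^~ 1%g =1 id by case=> x h; rewrite /act mulg1.
have actIM w : act_morph act w by move=> g h; rewrite /act mulgA.
pose W : gset gT := GSet (TotalAction actI1 actIM).
pose f' : gmap W (free_orbit gT) := @GMap gT W (free_orbit gT) snd (fun _ _ => erefl).
pose g' : gmap W X := @GMap gT W X (fun w => gset_act X (val w.1) w.2)
  (fun w g => actM (gset_act X) (val w.1) w.2 g).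
have pb : is_pullback f (orbit_map y) f' g'.
  split=> [[[x /eqP fx] h]|x h /= e] /=; first by rewrite gmap_equiv fx.
  have fx : f (gset_act X x h^-1%g) == y by rewrite gmap_equiv e actK.
  exists (exist _ (gset_act X x h^-1%g) fx : I, h); split=> [|[[x' fx'] h'] [/= ex eh]] /=.
    by rewrite actKV.
  by rewrite eh; congr pair; apply: val_inj; rewrite /= -ex eh actK.
have /= -> := push_pullback pb a; rewrite push_to_free.
under eq_bigr => w _ do
  rewrite -[res _ _]/((res _ \o res _) a) -res_comp gmap_comp_orbit_map.
rewrite -(pullback_fibre _ (fun x => res (orbit_map x) a) (1%g : free_orbit gT) pb).
by rewrite /= act1.
Qed.

End Pushforward.

Section Transfers.

Variables (gT : finGroupType) (k : tambara gT).
Implicit Types X Y Z : gset gT.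

Lemma tr_coproduct X Y Z (i : gmap X Z) (j : gmap Y Z) :
  is_coproduct i j ->
  forall c : k Z, c = tr i (res i c) + tr j (res j c).
Proof.
apply: (coproduct_split (op := fun X => (+%R : Monoid.com_law (0 : k X)))).
- by move=> *; apply/zmod_morph0/tr_zmod.
- by move=> *; apply/zmod_morphD/res_zmod.
- exact: tr_id.
- exact: tr_pullback.
Qed.

Lemma res_orbit_tr X Y (f : gmap X Y) (a : k X) (y : Y) :
  res (orbit_map y) (tr f a) = \sum_(x | f x == y) res (orbit_map x) a.
Proof.
apply: (res_orbit_push (op := fun X => (+%R : Monoid.com_law (0 : k X)))).
- by move=> *; apply/zmod_morph0/tr_zmod.
- by move=> *; apply/zmod_morphD/tr_zmod.
- by move=> *; apply/zmod_morphD/res_zmod.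
- exact: tr_id.
- exact: tr_comp.
- exact: tr_pullback.
Qed.

Lemma res_orbit_nm X Y (f : gmap X Y) (a : k X) (y : Y) :
  res (orbit_map y) (nm f a) = \prod_(x | f x == y) res (orbit_map x) a.
Proof.
apply: (res_orbit_push (op := fun X => ( *%R : Monoid.com_law (1 : k X)))).
- by move=> *; apply: (nm_monoid _ _).1.
- by move=> *; apply: (nm_monoid _ _).2.
- by move=> *; apply: (res_monoid _ _).2.
- exact: nm_id.
- exact: nm_comp.
- exact: nm_pullback.
Qed.

End Transfers.

(** * Monic morphisms and comparison with fixed points *)

Section Square.

Variables (gT : finGroupType) (k : tambara gT).
Implicit Types X Y Z W A B P : gset gT.

Definition sqlevel X : comPzRingType := (k X * k X)%type.

Definition sqmap X Y (h : k X -> k Y) (a : sqlevel X) : sqlevel Y := (h a.1, h a.2).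

Fact sqmap_zmod X Y (h : k X -> k Y) : zmod_morphism h -> zmod_morphism (sqmap h).
Proof. by move=> hB a b; rewrite /sqmap /= !hB. Qed.

Fact sqmap_monoid X Y (h : k X -> k Y) : monoid_morphism h -> monoid_morphism (sqmap h).
Proof. by case=> h1 hM; split=> [|a b]; rewrite /sqmap /= ?h1 ?hM. Qed.

Fact sqmap_id X (h : k X -> k X) : h =1 id -> sqmap h =1 id.
Proof. by move=> hE [a b]; rewrite /sqmap /= !hE. Qed.

Fact sqmap_comp X Y Z (h : k X -> k Z) (h1 : k X -> k Y) (h2 : k Y -> k Z) :
  h =1 h2 \o h1 -> sqmap h =1 sqmap h2 \o sqmap h1.
Proof. by move=> hE a; rewrite /sqmap /= !hE. Qed.

Fact sqmap_square X Y Y' Z (h1 : k X -> k Y) (h2 : k Y -> k Z)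
    (h1' : k X -> k Y') (h2' : k Y' -> k Z) :
  h2 \o h1 =1 h2' \o h1' -> sqmap h2 \o sqmap h1 =1 sqmap h2' \o sqmap h1'.
Proof.
by move=> e a; rewrite /sqmap /=; congr pair; [apply: (e a.1) | apply: (e a.2)].
Qed.

Fact sq_empty X : #|X| = 0%N -> forall a : sqlevel X, a = 0.
Proof. by move=> X0 [a b]; rewrite (level_empty X0 a) (level_empty X0 b). Qed.

Fact sq_coproduct X Y Z (i : gmap X Z) (j : gmap Y Z) :
  is_coproduct i j ->
  bijective (fun a : sqlevel Z => (sqmap (res i) a, sqmap (res j) a)).
Proof.
move=> /(level_coproduct k)[h hK Kh].
exists (fun ab => (h (ab.1.1, ab.2.1), h (ab.1.2, ab.2.2)) : sqlevel Z).
  by move=> [a b] /=; rewrite !hK.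
move=> [[a1 a2] [b1 b2]] /=; rewrite /sqmap /=.
by case: (Kh (a1, b1)) => -> ->; case: (Kh (a2, b2)) => -> ->.
Qed.

Fact sq_nm_tr A X Y P B (q : gmap A X) (f : gmap X Y)
    (e : gmap B A) (f' : gmap B P) (r : gmap P Y) :
  is_exponential q f e f' r ->
  sqmap (nm f) \o sqmap (tr q) =1 sqmap (tr r) \o sqmap (nm f') \o sqmap (res (t := k) e).
Proof.
move=> /(nm_tr (t := k))E a; rewrite /sqmap /=.
by congr pair; [apply: (E a.1) | apply: (E a.2)].
Qed.

Definition square_tambara : tambara gT :=
  Tambara
    (fun X Y f => sqmap_zmod (res_zmod (t := k) f))
    (fun X Y f => sqmap_monoid (res_monoid k f))
    (fun X Y f => sqmap_zmod (tr_zmod (t := k) f))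
    (fun X Y f => sqmap_monoid (nm_monoid k f))
    (fun X => sqmap_id (@res_id _ k X))
    (fun X => sqmap_id (@tr_id _ k X))
    (fun X => sqmap_id (@nm_id _ k X))
    (fun X Y Z g f => sqmap_comp (@res_comp _ k X Y Z g f))
    (fun X Y Z g f => sqmap_comp (@tr_comp _ k X Y Z g f))
    (fun X Y Z g f => sqmap_comp (@nm_comp _ k X Y Z g f))
    sq_empty sq_coproduct
    (fun X Y Y' W f g f' g' pb => sqmap_square (tr_pullback (t := k) pb))
    (fun X Y Y' W f g f' g' pb => sqmap_square (nm_pullback (t := k) pb))
    sq_nm_tr.

Variables (l : tambara gT) (f : tmor k l).

Section KernelPairLevel.
Variable X : gset gT.
Definition kerpair_pred : {pred square_tambara X} := fun ab => f X ab.1 == f X ab.2.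
Fact kerpair_subring : subring_closed kerpair_pred.
Proof.
split=> [|a b|a b]; rewrite -!topredE /= /kerpair_pred //=.
  by move=> /eqP ea /eqP eb; rewrite !(tmor_zmod f) ea eb.
by move=> /eqP ea /eqP eb; rewrite !(tmor_monoid f X).2 ea eb.
Qed.
HB.instance Definition _ :=
  GRing.isSubringClosed.Build (square_tambara X) kerpair_pred kerpair_subring.
End KernelPairLevel.

Definition kerpair_level X : subringClosed (square_tambara X) := @kerpair_pred X.

Fact kerpair_res X Y (h : gmap X Y) (a : square_tambara Y) :
  a \in kerpair_level Y -> res h a \in kerpair_level X.
Proof. by move=> /eqP ea; apply/eqP; rewrite /= !tmor_res ea. Qed.

Fact kerpair_tr X Y (h : gmap X Y) (a : square_tambara X) :
  a \in kerpair_level X -> tr h a \in kerpair_level Y.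
Proof. by move=> /eqP ea; apply/eqP; rewrite /= !tmor_tr ea. Qed.

Fact kerpair_nm X Y (h : gmap X Y) (a : square_tambara X) :
  a \in kerpair_level X -> nm h a \in kerpair_level Y.
Proof. by move=> /eqP ea; apply/eqP; rewrite /= !tmor_nm ea. Qed.

Definition kerpair_sub : subtambara square_tambara :=
  SubTambara kerpair_res kerpair_tr kerpair_nm.
Definition kerpair : tambara gT := sub_tambara kerpair_sub.

Definition kerpair_fst : tmor kerpair k :=
  @TMor _ kerpair k (fun X a => (sublevel_val a).1)
    (fun _ _ _ => erefl) (fun _ => (erefl, fun _ _ => erefl))
    (fun _ _ _ _ => erefl) (fun _ _ _ _ => erefl) (fun _ _ _ _ => erefl).

Definition kerpair_snd : tmor kerpair k :=
  @TMor _ kerpair k (fun X a => (sublevel_val a).2)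
    (fun _ _ _ => erefl) (fun _ => (erefl, fun _ _ => erefl))
    (fun _ _ _ _ => erefl) (fun _ _ _ _ => erefl) (fun _ _ _ _ => erefl).

(** The two projections of the kernel pair of [f] are equalized by [f], so they
    agree when [f] is monic. *)
Lemma monic_injective : Defs.monic f <-> forall X, injective (f X).
Proof.
split=> [fmonic X a b eab|finj m u v fuv X a]; last exact/finj/fuv.
have ab_ker : ((a, b) : square_tambara X) \in kerpair_level X by apply/eqP.
have uv Y (c : kerpair Y) : f Y (kerpair_fst Y c) = f Y (kerpair_snd Y c).
  exact/eqP/(sublevel_valP c).
exact: (fmonic _ _ _ uv X (SubLevel (ab_ker : _ \in sub_level kerpair_sub X))).
Qed.

End Square.

Lemma fixed_ext (gT : finGroupType) (R : gring [set: gT]) (X : gset gT)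
    (a b : fixed_tambara R X) :
  (forall x, (a : fixlevel R X) x = (b : fixlevel R X) x) -> a = b.
Proof. exact: Defs.eqfunP. Qed.

(** One half of the adjunction between the bottom level and the fixed-point
    functor, its right adjoint: a morphism [psi] of rings with action extends to
    all levels. *)
Section Comparison.

Variables (gT : finGroupType) (k : tambara gT) (R : gring [set: gT]).
Variable psi : {rmorphism bottom k -> R}.
Hypothesis psi_act : forall a g,
  psi (gring_act (bottom k) a g) = gring_act R (psi a) g.
Implicit Types X Y : gset gT.

Fact comparison_subproof X (a : k X) :
  [ffun x => psi (res (orbit_map x) a)] \in eqfun_pred (gset_act X) R.
Proof.
apply/eqfun_predP => x g _; rewrite !ffunE -psi_act orbit_map_act.
exact: (congr1 psi (res_comp (orbit_map x) (ltrans g) a)).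
Qed.

Definition comparison_fun X (a : k X) : fixed_tambara R X :=
  EqFun (comparison_subproof a).

Fact comparison_zmod X : zmod_morphism (@comparison_fun X).
Proof. by move=> a b; apply: fixed_ext => x; rewrite !ffunE res_zmod rmorphB. Qed.

Fact comparison_monoid X : monoid_morphism (@comparison_fun X).
Proof.
have psi1 : psi 1 = 1 := rmorph1 psi.
have psiM : {morph psi : a b / a * b} := rmorphM psi.
split=> [|a b]; apply: fixed_ext => x; rewrite !ffunE.
  by rewrite (res_monoid k _).1.
by rewrite (res_monoid k _).2.
Qed.

Fact comparison_res X Y (f : gmap X Y) (a : k Y) :
  comparison_fun (res f a) = res f (comparison_fun a).
Proof.
apply: fixed_ext => x; rewrite !ffunE -gmap_comp_orbit_map.
by rewrite (res_comp f (orbit_map x) a).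
Qed.

Fact comparison_tr X Y (f : gmap X Y) (a : k X) :
  comparison_fun (tr f a) = tr f (comparison_fun a).
Proof.
apply: fixed_ext => y; rewrite !ffunE res_orbit_tr rmorph_sum.
by apply: eq_bigr => x _; rewrite ffunE.
Qed.

Fact comparison_nm X Y (f : gmap X Y) (a : k X) :
  comparison_fun (nm f a) = nm f (comparison_fun a).
Proof.
apply: fixed_ext => y; rewrite !ffunE res_orbit_nm rmorph_prod.
by apply: eq_bigr => x _; rewrite ffunE.
Qed.

Definition comparison : tmor k (fixed_tambara R) :=
  TMor comparison_zmod comparison_monoid comparison_res comparison_tr comparison_nm.

End Comparison.

Section Image.

Variables (gT : finGroupType) (k l : tambara gT) (f : tmor k l).
Implicit Types X Y : gset gT.

Section Level.
Variable X : gset gT.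
Definition image_pred : {pred l X} := fun b => `[< exists a, f X a = b >].

Lemma image_predP b : reflect (exists a, f X a = b) (b \in image_pred).
Proof. exact: asboolP. Qed.

Fact image_subring : subring_closed image_pred.
Proof.
split=> [|_ _ /image_predP[a <-] /image_predP[b <-]
         |_ _ /image_predP[a <-] /image_predP[b <-]]; apply/image_predP.
- by exists 1; apply: (tmor_monoid f X).1.
- by exists (a - b); apply: (tmor_zmod f).
- by exists (a * b); apply: (tmor_monoid f X).2.
Qed.
HB.instance Definition _ :=
  GRing.isSubringClosed.Build (l X) image_pred image_subring.
End Level.

Definition image_level X : subringClosed (l X) := @image_pred X.

Fact image_res X Y (h : gmap X Y) (b : l Y) :
  b \in image_level Y -> res h b \in image_level X.
Proof. by case/image_predP=> a <-; apply/image_predP; exists (res h a); rewrite tmor_res. Qed.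

Fact image_tr X Y (h : gmap X Y) (b : l X) :
  b \in image_level X -> tr h b \in image_level Y.
Proof. by case/image_predP=> a <-; apply/image_predP; exists (tr h a); rewrite tmor_tr. Qed.

Fact image_nm X Y (h : gmap X Y) (b : l X) :
  b \in image_level X -> nm h b \in image_level Y.
Proof. by case/image_predP=> a <-; apply/image_predP; exists (nm h a); rewrite tmor_nm. Qed.

Definition tambara_image : subtambara l := SubTambara image_res image_tr image_nm.

Lemma tambara_imageP X (b : l X) : reflect (exists a, f X a = b) (b \in sub_level tambara_image X).
Proof. exact: image_predP. Qed.

Definition corestr_fun X (a : k X) : sub_tambara tambara_image X :=
  SubLevel (introT (tambara_imageP (f X a)) (ex_intro _ a erefl)).

Definition corestr : tmor k (sub_tambara tambara_image).
Proof.
exists corestr_fun => [X a b|X|X Y h a|X Y h a|X Y h a].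
- exact/val_inj/(tmor_zmod f).
- split=> [|a b]; first exact/val_inj/(tmor_monoid f X).1.
  exact/val_inj/(tmor_monoid f X).2.
- exact/val_inj/tmor_res.
- exact/val_inj/tmor_tr.
- exact/val_inj/tmor_nm.
Defined.

Lemma corestr_iso : (forall X, injective (f X)) -> tambara_iso corestr.
Proof.
move=> finj X; have pre (b : sub_tambara tambara_image X) : exists a, f X a == sublevel_val b.
  by have /tambara_imageP[a <-] := sublevel_valP b; exists a.
exists (fun b => xchoose (pre b)) => [a|b].
  exact/finj/eqP/(xchooseP (pre (corestr_fun a))).
exact/val_inj/eqP/(xchooseP (pre b)).
Qed.

End Image.

(** * The quotient by a nonunit *)

Section PrincipalQuotient.
Local Open Scope quotient_scope.

Variables (R : comNzRingType) (x : R).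
Hypothesis xNunit : forall y, x * y <> 1.

Definition principal_ideal : {pred R} := fun z => `[< exists y, z = x * y >].

Fact principal_ideal_closed : idealr_closed principal_ideal.
Proof.
split=> [||a _ _ /asboolP[u ->] /asboolP[v ->]].
- by apply/asboolP; exists 0; rewrite mulr0.
- by apply/asboolP => -[y /esym/xNunit].
- by apply/asboolP; exists (a * u + v); rewrite mulrDr mulrCA.
Qed.

Definition principal_idealr : idealr R :=
  HB.pack_for (idealr R) principal_ideal (isIdealr.Build R principal_ideal principal_ideal_closed).

Lemma pi_principal : \pi_{ideal_quot principal_idealr} x = 0.
Proof.
apply/eqP; rewrite -[0]pi_zeror -Quotient.idealrBE subr0.
by apply/asboolP; exists 1; rewrite mulr1.
Qed.

End PrincipalQuotient.

(** The multiples of a nonunit form a proper ideal. *)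
Lemma nonunit_quotient (R : comPzRingType) (x : R) :
  (forall y, x * y <> 1) ->
  exists (Q : comPzRingType) (pi : {rmorphism R -> Q}), 1 <> 0 :> Q /\ pi x = 0.
Proof.
move=> xNunit.
have R10 : 1 != 0 :> R.
  by apply/eqP => R10; apply: (xNunit 0); rewrite mulr0.
pose R' := HB.pack_for comNzRingType R (GRing.PzSemiRing_isNonZero.Build R R10).
pose Q : comNzRingType := {ideal_quot (principal_idealr (R := R') xNunit)}.
pose pi : {rmorphism R' -> Q} := \pi_Q%qT.
exists Q, pi; split; first exact/eqP/oner_neq0.
exact: pi_principal.
Qed.

(** * Field-like and clarified functors *)

Section FieldLike.

Variable gT : finGroupType.
Implicit Types (k l : tambara gT) (X Y : gset gT).

Lemma field_like_injective k l (f : tmor k l) :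
  field_like k -> nonzero l -> forall X, injective (f X).
Proof. by move=> [_ kmonic] l0; apply/monic_injective/kmonic. Qed.

Lemma nonzero_fixed (R : gring [set: gT]) : 1 <> 0 :> R -> nonzero (fixed_tambara R).
Proof.
move=> R10; exists (point gT), 1; apply/eqP.
move=> /(congr1 (fun a : fixlevel R (point gT) => a tt)).
by rewrite !ffunE.
Qed.

(** For a nonunit [x] the comparison attached to the quotient by [(x)] has nonzero
    target, hence is injective; as it kills [x], this gives [x = 0]. *)
Lemma trivial_bottom_field k :
  field_like k -> trivial_bottom k -> 1 <> 0 :> k (free_orbit gT) ->
  is_field (k (free_orbit gT)).
Proof.
move=> kfield ktriv F10; split=> // x x0; apply: contrapT => /forallNP xNunit.
have [Q [pi [Q10 pix]]] := nonunit_quotient xNunit.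
pose psi : {rmorphism bottom k -> trivial_gring gT Q} := pi.
have psi_act a g : psi (gring_act (bottom k) a g) = gring_act (trivial_gring gT Q) (psi a) g.
  by rewrite ktriv.
apply: x0.
apply: (field_like_injective (f := comparison psi_act) kfield); first exact: nonzero_fixed.
have pi0 : pi 0 = 0 := raddf0 pi.
apply: fixed_ext => g; rewrite !ffunE orbit_map_free.
rewrite -![res _ _]/(gring_act (bottom k) _ g) !ktriv.
by rewrite -!/(pi _) pix pi0.
Qed.

(** Zero is transferred from the empty set. For surjective [f] the dependent
    product of the empty set along [f] is empty, since no section exists over a
    nonempty fibre; so the norm of zero is again a transfer from the empty set. *)
Lemma nm0 k X Y (f : gmap X Y) :
  (forall y, exists x, f x = y) -> nm f (0 : k X) = 0.
Proof.
move=> fsurj; pose E := empty_gset gT.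
have ex : is_exponential (from_empty X) f (gmap_id E) (gmap_id E) (from_empty Y).
  split; first by split=> [[]|x []].
  by move=> y s; have [x /eqP fx] := fsurj y; case: (s (exist _ x fx)).
have /= := nm_tr ex (0 : k E).
rewrite !(zmod_morph0 (@tr_zmod _ k _ _ _)) => ->.
rewrite (level_empty (card_empty_gset gT) (nm _ _)).
exact/zmod_morph0/tr_zmod.
Qed.

(** The norm from the bottom to the top level maps 1 to 1 and 0 to 0, so the top
    level vanishes with the bottom one; every level is a ring under the top. *)
Lemma zero_from_free k : 1 = 0 :> k (free_orbit gT) -> ~ nonzero k.
Proof.
move=> free0 [X [a /eqP[]]].
have point0 : 1 = 0 :> k (point gT).
  rewrite -(nm_monoid k (to_point (free_orbit gT))).1 free0.
  by apply: nm0 => -[]; exists 1%g.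
have X0 : 1 = 0 :> k X.
  by rewrite -(res_monoid k (to_point X)).1 point0; apply/zmod_morph0/res_zmod.
by rewrite -[a]mulr1 X0 mulr0.
Qed.

(** In a ring coinduced from [H] the indicator function of [H] is moved by every
    [g] outside [H], unless the ring is zero. *)
Lemma trivial_bottom_clarified k :
  trivial_bottom k -> 1 <> 0 :> k (free_orbit gT) -> clarified k.
Proof.
move=> ktriv F10 [H [R [/properP[_ [g _ gH]] [phi [phi_bij phi_act]]]]].
pose ind : {ffun gT -> R} := [ffun x => if x \in H then 1 else 0].
have ind_eq : ind \in eqfun_pred ('R \ subsetT H)%act R.
  apply/eqfun_predP => x h Hh; rewrite !ffunE /= groupMr //.
  case: ifP => _; first by rewrite (gring_act_monoid Hh).1.
  by rewrite (zmod_morph0 (gring_act_zmod Hh)).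
pose a : coind R := EqFun ind_eq.
have [phi' phiK phi'K] := phi_bij.
have act_a : gring_act (coind R) a g = a by rewrite -[a]phi'K -phi_act ?inE // ktriv.
have R10 : 1 = 0 :> R.
  have /(congr1 (fun b : coind_ring R => b 1%g)) := act_a.
  by rewrite !ffunE mulg1 (negPf gH) group1.
apply: F10; apply: (can_inj phiK); rewrite rmorph1 rmorph0.
by apply: Defs.eqfunP => x; rewrite !ffunE.
Qed.

(** An element of a level of [S] is recovered from its restrictions to two
    summands as the sum of their transfers, so [S] detects membership orbit by
    orbit. *)
Lemma sub_level_orbits k (S : subtambara k) (prime_order : prime #|[set: gT]|) X (a : k X) :
  a \in sub_level S X <->
  (forall i : gmap (free_orbit gT) X, res i a \in sub_level S _) /\
  (forall i : gmap (point gT) X, res i a \in sub_level S _).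
Proof.
split=> [Sa|]; first by split=> i; apply: sub_res.
elim/(gset_orbit_ind prime_order): X a => [X X0|X Z i j ij IH|X Z i j ij IH] a [afree apoint].
- by rewrite (level_empty X0 a) rpred0.
- rewrite (tr_coproduct ij a) rpredD //; first exact/sub_tr/afree.
  apply/sub_tr/IH; split=> h; rewrite -[res h _]/((res h \o res j) a) -res_comp;
    [exact: afree | exact: apoint].
- rewrite (tr_coproduct ij a) rpredD //; first exact/sub_tr/apoint.
  apply/sub_tr/IH; split=> h; rewrite -[res h _]/((res h \o res j) a) -res_comp;
    [exact: afree | exact: apoint].
Qed.

End FieldLike.

(** * The functor attached to a subfield *)

Section InvariantBigop.

Variables (gT : finGroupType) (X : gset gT).
Hypothesis prime_order : prime #|[set: gT]|.
Variables (T : Type) (idx : T) (op : Monoid.com_law idx) (Q : T -> Prop).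
Hypotheses (Q_idx : Q idx) (Q_op : forall a b, Q a -> Q b -> Q (op a b)).
Variables (P : pred X) (a : X -> T).
Hypotheses (P_act : forall x g, P (gset_act X x g) = P x)
           (a_act : forall x g, a (gset_act X x g) = a x).

(** On a fixed point the function contributes its value, on a free orbit the
    [#|G|]-fold iterate of a single value. *)
Lemma invariant_bigop :
  (forall x, fixed_point x -> Q (a x)) ->
  (forall x, Q (iter #|[set: gT]| (op (a x)) idx)) ->
  Q (\big[op/idx]_(x | P x) a x).
Proof.
move=> Qfixed Qfree; pose o := orbit (gset_act X) [set: gT].
rewrite (partition_big o predT) //; apply: big_ind => // O _.
have [x /andP[Px /eqP oxO]|noO] := pickP (fun x => P x && (o x == O)); last by rewrite big_pred0.
have orbE z : P z && (o z == O) = (z \in o x).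
  rewrite -oxO orbit_eq_mem andb_idl //.
  by case/orbitP=> g _ <-; rewrite P_act.
rewrite (eq_bigl _ _ orbE).
have [xfix|oinj] := orbit_dichotomy prime_order x.
  rewrite (big_pred1 x) => [|z]; first exact: Qfixed.
  apply/orbitP/eqP => [[g _ <-]|->]; first exact: xfix.
  by exists 1%g; rewrite ?inE ?act1.
rewrite big_imset => [|g h _ _ /oinj] //=.
under eq_bigr => g _ do rewrite a_act.
by rewrite big_const; apply: Qfree.
Qed.

End InvariantBigop.

(** [Etr] and [Enm] say that [E] contains the transfer and the norm of [x] from
    the bottom level when the action is trivial. *)
Section SubfieldFunctor.

Variables (gT : finGroupType) (F : comPzRingType) (E : F -> Prop).
Hypothesis prime_order : prime #|[set: gT]|.
Hypotheses (E1 : E 1) (EB : forall x y, E x -> E y -> E (x - y))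
           (EM : forall x y, E x -> E y -> E (x * y)).
Hypotheses (Etr : forall x, E (x *+ #|[set: gT]|))
           (Enm : forall x, E (x ^+ #|[set: gT]|)).
Local Notation Fbar := (fixed_tambara (trivial_gring gT F)).
Implicit Types X Y : gset gT.

Section Level.
Variable X : gset gT.
Definition fixed_in_pred : {pred Fbar X} :=
  fun a => `[< forall x : X, fixed_point x -> E ((a : fixlevel _ X) x) >].

Lemma fixed_in_predP (a : Fbar X) :
  reflect (forall x : X, fixed_point x -> E ((a : fixlevel _ X) x)) (a \in fixed_in_pred).
Proof. exact: asboolP. Qed.

Fact fixed_in_subring : subring_closed fixed_in_pred.
Proof.
split=> [|a b /fixed_in_predP Ea /fixed_in_predP Eb
         |a b /fixed_in_predP Ea /fixed_in_predP Eb];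
  apply/fixed_in_predP => x xfix; rewrite !ffunE.
- exact: E1.
- by apply: EB; [apply: Ea | apply: Eb].
- by apply: EM; [apply: Ea | apply: Eb].
Qed.
End Level.

Definition fixed_in_level X : subringClosed (Fbar X) :=
  HB.pack_for (subringClosed (Fbar X)) (@fixed_in_pred X)
    (GRing.isSubringClosed.Build (Fbar X) (@fixed_in_pred X) (@fixed_in_subring X)).

Lemma fixlevel_act X (a : fixlevel (trivial_gring gT F) X) x g : a (gset_act X x g) = a x.
Proof. by rewrite eqfun_equiv ?inE. Qed.

Fact fixed_in_res X Y (f : gmap X Y) (a : Fbar Y) :
  a \in fixed_in_level Y -> res f a \in fixed_in_level X.
Proof.
move=> /fixed_in_predP Ea; apply/fixed_in_predP => x xfix; rewrite ffunE.
by apply: Ea => g; rewrite -gmap_equiv xfix.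
Qed.

Lemma fibre_fixed_act X Y (f : gmap X Y) y :
  fixed_point y -> forall x g, (f (gset_act X x g) == y) = (f x == y).
Proof.
by move=> yfix x g; rewrite gmap_equiv -[in LHS](yfix g) (inj_eq (act_inj _ g)).
Qed.

Fact fixed_in_tr X Y (f : gmap X Y) (a : Fbar X) :
  a \in fixed_in_level X -> tr f a \in fixed_in_level Y.
Proof.
move=> /fixed_in_predP Ea; apply/fixed_in_predP => y yfix; rewrite ffunE.
have E0 : E 0 by rewrite -(subrr 1); apply: EB.
apply: (invariant_bigop prime_order E0) => //.
- by move=> b c Eb Ec; rewrite -[c]opprK; apply: EB => //; rewrite -sub0r; apply: EB.
- exact: fibre_fixed_act.
- exact: fixlevel_act.
by move=> x; rewrite -Monoid.iteropE; apply: Etr.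
Qed.

Fact fixed_in_nm X Y (f : gmap X Y) (a : Fbar X) :
  a \in fixed_in_level X -> nm f a \in fixed_in_level Y.
Proof.
move=> /fixed_in_predP Ea; apply/fixed_in_predP => y yfix; rewrite ffunE.
apply: (invariant_bigop prime_order E1) => //.
- exact: fibre_fixed_act.
- exact: fixlevel_act.
by move=> x; rewrite -Monoid.iteropE; apply: Enm.
Qed.

Definition subfield_tambara : subtambara Fbar :=
  SubTambara fixed_in_res fixed_in_tr fixed_in_nm.

Lemma not_fixed_free (x : free_orbit gT) : ~ fixed_point x.
Proof.
move=> xfix; have := prime_gt1 prime_order.
rewrite (_ : [set: gT] = [set 1%g]) ?cards1 //; apply/setP => g; rewrite !inE.
by apply/esym/eqP/(mulgI x); rewrite mulg1; apply: xfix.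
Qed.

Lemma subfield_tambara_levels : has_levels E subfield_tambara.
Proof.
split=> a; first by apply/fixed_in_predP => x /not_fixed_free.
by split=> [/fixed_in_predP Ea|Ea]; [apply: Ea | apply/fixed_in_predP => -[]].
Qed.

End SubfieldFunctor.

Section Levels.

Variables (gT : finGroupType) (F : comPzRingType) (E : F -> Prop).
Hypothesis prime_order : prime #|[set: gT]|.
Local Notation Fbar := (fixed_tambara (trivial_gring gT F)).
Implicit Types S : subtambara Fbar.

Lemma has_levels_unique S S' :
  has_levels E S -> has_levels E S' -> forall X, sub_level S' X =i sub_level S X.
Proof.
move=> [Sfree Spoint] [S'free S'point] X a.
by apply/idP/idP => /(sub_level_orbits _ prime_order)[_ apoint];
  apply/(sub_level_orbits _ prime_order); split=> i //;
  [apply/Spoint/S'point | apply/S'point/Spoint].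
Qed.

Lemma sub_trivial_bottom S : trivial_bottom (sub_tambara S).
Proof.
move=> a g; apply/val_inj/fixed_ext => x.
rewrite ffunE -[ltrans g x]/(g * x)%g -[(g * x)%g](mulKVg x).
exact: (fixlevel_act _ _ _).
Qed.

Fact const_subproof X (c : F) :
  [ffun=> c] \in eqfun_pred (gset_act X) (trivial_gring gT F).
Proof. by apply/eqfun_predP => x g _; rewrite !ffunE. Qed.

Definition const_fix X (c : F) : Fbar X := EqFun (const_subproof X c).

Section Evaluation.

Variables (S : subtambara Fbar) (X : gset gT) (x : X).

Definition eval_at (a : sub_tambara S X) : F := (sublevel_val a : fixlevel _ X) x.

Fact eval_at_zmod : zmod_morphism eval_at.
Proof. by move=> a b; rewrite /eval_at !ffunE. Qed.

Fact eval_at_monoid : monoid_morphism eval_at.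
Proof. by split=> [|a b]; rewrite /eval_at !ffunE. Qed.

HB.instance Definition _ :=
  GRing.isZmodMorphism.Build (sub_tambara S X) F eval_at eval_at_zmod.
HB.instance Definition _ :=
  GRing.isMonoidMorphism.Build (sub_tambara S X) F eval_at eval_at_monoid.

End Evaluation.

Lemma eval_at_ext S X (a b : sub_tambara S X) :
  (forall x, eval_at x a = eval_at x b) -> a = b.
Proof. by move=> eab; apply/val_inj/fixed_ext. Qed.

Lemma eval_at_res S X Y (h : gmap X Y) (a : sub_tambara S Y) x :
  eval_at x (res h a) = eval_at (h x) a.
Proof. by rewrite {1}/eval_at /= ffunE. Qed.

Lemma eval_at_act S X (a : sub_tambara S X) x g : eval_at (gset_act X x g) a = eval_at x a.
Proof. exact: fixlevel_act. Qed.

Lemma sub_has_char S n : has_char F n -> has_char (sub_tambara S (free_orbit gT)) n.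
Proof.
move=> charF m; rewrite -charF; split=> [m0|m0].
  have := congr1 (eval_at (1%g : free_orbit gT)) m0.
  by rewrite rmorph_nat rmorph0.
by apply: eval_at_ext => x; rewrite rmorph_nat rmorph0.
Qed.

(** A nonzero element has a nonzero value [c] at some [x], so its restriction along
    [orbit_map x] is the constant function [c], which the constant function [1 / c]
    inverts. A morphism that kills the element therefore kills 1 at the bottom. *)
Lemma sub_field_like S : is_field F ->
  (forall a, a \in sub_level S (free_orbit gT)) -> field_like (sub_tambara S).
Proof.
move=> [F10 Finv] Sfree; split.
  exists (free_orbit gT), 1; apply/eqP => /(congr1 (eval_at (1%g : free_orbit gT))).
  by rewrite rmorph1 rmorph0.
move=> l f l0; apply/monic_injective => X a b fab; apply: eval_at_ext => x.
apply: contrapT => neq_ab; pose c := eval_at x (a - b).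
have c0 : c <> 0 by rewrite /c rmorphB => /subr0_eq.
have fc : f X (a - b) = 0 by rewrite (tmor_zmod f) fab subrr.
have [d cd] := Finv c c0.
apply: (zero_from_free (k := l)) l0.
pose d' : sub_tambara S (free_orbit gT) := SubLevel (Sfree (const_fix _ d)).
have cd1 : res (orbit_map x) (a - b) * d' = 1.
  apply: eval_at_ext => g; rewrite rmorphM rmorph1 -cd; congr (_ * _); last exact: ffunE.
  rewrite -[LHS]/(eval_at g (res (orbit_map x) (a - b))) eval_at_res.
  exact: eval_at_act.
rewrite -(tmor_monoid f _).1 -cd1 (tmor_monoid f _).2 tmor_res fc.
by rewrite (zmod_morph0 (@res_zmod _ l _ _ _)) mul0r.
Qed.

End Levels.

(** * The embedding into the fixed-point functor, and the classification *)

Lemma has_char_prime_neq0 (R : comPzRingType) (p : nat) :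
  prime p -> has_char R p -> 1 <> 0 :> R.
Proof. by move=> p_prime charR /(charR 1%N).1; rewrite dvdn1 => /eqP p1; rewrite p1 in p_prime. Qed.

(** The action on the bottom level is trivial, but not by definition, so
    [trivial_gring gT F] is another ring with action; the identity of [F] is
    equivariant between the two. *)
Section IdentityComparison.

Variables (gT : finGroupType) (k : tambara gT).
Hypothesis ktriv : trivial_bottom k.
Local Notation F := (k (free_orbit gT)).

Definition bottom_id : {rmorphism bottom k -> trivial_gring gT F} :=
  idfun : {rmorphism F -> F}.

Fact bottom_id_act a g :
  bottom_id (gring_act (bottom k) a g) = gring_act (trivial_gring gT F) (bottom_id a) g.
Proof. by rewrite ktriv. Qed.

Definition to_fixed : tmor k (fixed_tambara (trivial_gring gT F)) :=
  comparison bottom_id_act.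

Lemma to_fixedE X (a : k X) x :
  (to_fixed X a : fixlevel (trivial_gring gT F) X) x = res (orbit_map x) a.
Proof. exact: ffunE. Qed.

Lemma to_fixed_free (a : F) g :
  (to_fixed _ a : fixlevel (trivial_gring gT F) (free_orbit gT)) g = a.
Proof. by rewrite to_fixedE orbit_map_free; apply: ktriv. Qed.

Lemma to_fixed_point (a : k (point gT)) :
  (to_fixed _ a : fixlevel (trivial_gring gT F) (point gT)) tt = res_top a.
Proof. by rewrite to_fixedE orbit_map_point. Qed.

Lemma to_fixed_levels :
  has_levels (fun y => exists x, res_top x = y) (tambara_image to_fixed).
Proof.
split=> a.
  apply/tambara_imageP; exists ((a : fixlevel _ _) 1%g); apply: fixed_ext => g.
  by rewrite to_fixed_free -[g in RHS]mul1g (fixlevel_act _ (1%g : free_orbit gT)).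
split=> [/tambara_imageP[x <-]|[x ex]]; first by exists x; rewrite to_fixed_point.
by apply/tambara_imageP; exists x; apply: fixed_ext => -[]; rewrite to_fixed_point.
Qed.

(** The fibre of [G/e -> G/G] is all of [G], and each of its points contributes the
    same factor. *)
Lemma res_top_nm (x : F) :
  res_top (nm (to_point (free_orbit gT)) x) = x ^+ #|[set: gT]|.
Proof.
rewrite /res_top -orbit_map_point res_orbit_nm -[RHS]prodr_const.
apply: eq_big => g; first by rewrite inE; apply/eqP.
by move=> _; rewrite -to_fixedE to_fixed_free.
Qed.

End IdentityComparison.

Theorem proposition1p5 (p : nat) (p_prime : prime p)
    (gT : finGroupType) (G_cyclic : cyclic [set: gT]) (G_order : #|[set: gT]| = p) :
  (forall k : tambara gT,
     field_like k -> clarified k -> has_char (k (free_orbit gT)) p ->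
     trivial_bottom k ->
     let F := k (free_orbit gT) in
     let E := fun y : F => exists x : k (point gT), res_top x = y in
     [/\ is_field F,
         injective (@res_top gT k),
         is_subfield E,
         forall x : F, E (x ^+ p) &
         exists S : subtambara (fixed_tambara (trivial_gring gT F)),
           has_levels E S /\
           exists phi : tmor k (sub_tambara S),
             tambara_iso phi /\
             forall a : F, sublevel_val (phi (free_orbit gT) a) 1%g = a]) /\
  (forall (F : comPzRingType) (E : F -> Prop),
     is_field F -> has_char F p -> is_subfield E ->
     (forall x : F, E (x ^+ p)) ->
     exists S : subtambara (fixed_tambara (trivial_gring gT F)),
       [/\ has_levels E S,
           forall S' : subtambara (fixed_tambara (trivial_gring gT F)),
             has_levels E S' -> forall X, sub_level S' X =i sub_level S X &
           [/\ field_like (sub_tambara S),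
               clarified (sub_tambara S),
               has_char (sub_tambara S (free_orbit gT)) p &
               trivial_bottom (sub_tambara S)]]).
Proof.
split=> [k kfield _ kchar ktriv F E | F E F_field F_char [E1 EB EM _] Efrob].
  have F10 : 1 <> 0 :> F := has_char_prime_neq0 p_prime kchar.
  have F_field : is_field F by apply: trivial_bottom_field.
  have inj X : injective (to_fixed ktriv X).
    by apply: (field_like_injective kfield); apply: nonzero_fixed.
  have resB := res_zmod (t := k) (to_point (free_orbit gT)).
  have [res1 resM] := res_monoid k (to_point (free_orbit gT)).
  have Efrob (x : F) : E (x ^+ p).
    by exists (nm (to_point _) x); rewrite res_top_nm // G_order.
  have EM (x y : F) : E x -> E y -> E (x * y).
    by move=> [a <-] [b <-]; exists (a * b); apply: resM.
  have E1 : E 1 by exists 1.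
  split=> // [a b eab||].
  - by apply: inj; apply: fixed_ext => -[]; rewrite !to_fixed_point.
  - split=> // [_ _ [a <-] [b <-]|x Ex x0]; first by exists (a - b); apply: resB.
    have [y xy] := F_field.2 x x0.
    (* The inverse of [x], rewritten so that only [p]-th powers are inverted. *)
    exists (y ^+ p * x ^+ p.-1).
      apply: (EM _ _ (Efrob y)); elim: p.-1 => [|n IHn]; first by rewrite expr0.
      by rewrite exprS; apply: EM.
    by rewrite mulrCA -exprS prednK ?prime_gt0 // -exprMn mulrC xy expr1n.
  exists (tambara_image (to_fixed ktriv)); split; first exact: to_fixed_levels.
  exists (corestr (to_fixed ktriv)); split; first exact: corestr_iso.
  by move=> a; apply: to_fixed_free.
have prime_order : prime #|[set: gT]| by rewrite G_order.
have Etr (x : F) : E (x *+ #|[set: gT]|).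
  have p0 : p%:R = 0 :> F by apply/F_char.
  by rewrite G_order -mulr_natr p0 mulr0 -(subrr 1); apply: EB.
have Enm (x : F) : E (x ^+ #|[set: gT]|) by rewrite G_order.
pose S := subfield_tambara prime_order E1 EB EM Etr Enm.
have S_levels : has_levels E S := subfield_tambara_levels _ _ _ _ _ _.
have S_triv : trivial_bottom (sub_tambara S) by apply: sub_trivial_bottom.
have S_char := sub_has_char S F_char.
exists S; split=> // [S' S'_levels|].
  exact: (has_levels_unique prime_order S_levels).
split=> //; first exact: sub_field_like F_field S_levels.1.
exact/trivial_bottom_clarified/(has_char_prime_neq0 p_prime S_char).
Qed.
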